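(* Fix $(\tau,e)\in D_s$ with $\tau>0$, $e>0$, and consider the dynamical system for $\mathbf r=(\alpha,\varphi,\xi)\in\,]0,1[^3$: $$\begin{cases} \dot\alpha=\alpha(1-\alpha)\,\tau\Big(\dfrac{p_1}{T_1}-\dfrac{p_2}{T_2}\Big),\\[2mm] \dot\varphi=\varphi(1-\varphi)\Big(\dfrac{\mu_2}{T_2}-\dfrac{\mu_1}{T_1}\Big),\\[2mm] \dot\xi=\xi(1-\xi)\,e\Big(\dfrac1{T_1}-\dfrac1{T_2}\Big), \end{cases}$$ where $p_i,T_i,\mu_i$ denote the values of $p,T,\mu$ at $(\tau_i(\mathbf r),e_i(\mathbf r))$, $i=1,2$, with $$\tau_1(\mathbf r)=\frac{\alpha\tau}{\varphi},\quad \tau_2(\mathbf r)=\frac{(1-\alpha)\tau}{1-\varphi},\quad e_1(\mathbf r)=\frac{\xi e}{\varphi},\quad e_2(\mathbf r)=\frac{(1-\xi)e}{1-\varphi}.$$ Let $\mathscr S(\mathbf r)=\varphi\, s(\tau_1(\mathbf r),e_1(\mathbf r))+(1-\varphi)\,s(\tau_2(\mathbf r),e_2(\mathbf r))$ and $$G_S(\mathbf r)=-\mathscr S(\mathbf r)+\mathrm{conc}(s)(\tau,e),\qquad G_I(\mathbf r)=-\mathscr S(\mathbf r)+s(\tau,e).$$ The basins of attraction of the equilibrium states are as follows. - If $(\tau,e)\in Z_{\mathrm{Spinodal}}$, then $G_S$ is a Lyapunov function (for the saturation equilibria $\mathbf r^*,\mathbf r^\#$) on the whole domain $(\alpha,\varphi,\xi)\in\,]0,1[^3$.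 - If $(\tau,e)\in Z_{\mathrm{Stable}}$ (liquid or vapor stable zones), then $G_I$ is a Lyapunov function (for the equilibria $\overline{\mathbf r}=(\beta,\beta,\beta)$, $\beta\in\,]0,1[$) on the whole domain $(\alpha,\varphi,\xi)\in\,]0,1[^3$.
   Context: Notation: $\mathbb{R}^+=[0,+\infty)$. Fixed constants: $R>0$, $C_v>0$, $a\ge 0$, $b\ge 0$, $s_0\in\mathbb{R}$. The van der Waals specific entropy is $$s(\tau,e)=C_v\ln\Big(\frac{a}{\tau}+e\Big)+R\ln(\tau-b)+s_0,$$ defined on $D_s=\{(\tau,e)\in(\mathbb{R}^+)^2:\ \tau>b,\ \frac a\tau+e>0\}$. Temperature and pressure are $$T(\tau,e)=\frac1{C_v}\Big(e+\frac a\tau\Big)=\Big(\frac{\partial s}{\partial e}\Big)^{-1},\qquad p(\tau,e)=\frac{R\,T(\tau,e)}{\tau-b}-\frac{a}{\tau^2}=T\,\frac{\partial s}{\partial\tau},$$ and the chemical potential is $\mu(\tau,e)=e+p(\tau,e)\tau-T(\tau,e)s(\tau,e)$. The functions $\mathscr S$, $G_S$, $G_I$ and the right-hand side of the system are defined for $\mathbf r\in\,]0,1[^3$ with both $(\tau_i(\mathbf r),e_i(\mathbf r))\in D_s$; ''the whole domain'' refers to all such $\mathbf r$. The concave hull $\mathrm{conc}(s)$ is the smallest concave function on $D_s$ that is $\ge s$. Zones. Let $g(\tau)=\frac{2aC_v(\tau-b)^2}{R\tau^3}-\frac a\tau$ and $Z_{\mathrm{Spinodal}}=\{(\tau,e)\in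 D_s:\ e<g(\tau)\}$ (the region where $s$ is not locally concave). The saturation dome is the set of all states $(\tau_1^*,e_1^* )$, $(\tau_2^*,e_2^* )$ that form a saturation couple, i.e. two distinct states with equal pressures, temperatures and chemical potentials, whose joining segment (lifted to the graph of $s$ at its endpoints) lies in the graph of $\mathrm{conc}(s)$; it is assumed to be the graph of a function $\tau\mapsto g^*(\tau)$. Let $T_c$ be the critical temperature, i.e. the unique temperature for which the isotherm $\tau\mapsto p(\tau,T)=\frac{RT}{\tau-b}-\frac a{\tau^2}$ has a point where both its first and second derivatives in $\tau$ vanish, and $e(\tau,T_c)=C_vT_c-\frac a\tau$. Then $Z_{\mathrm{Stable}}=\{(\tau,e)\in D_s:\ g^*(\tau)<e<e(\tau,T_c)\}$. Equilibria. $\mathbf r^*=(\alpha^*,\varphi^*,\xi^* )$ is the fraction vector for which $(\tau_i(\mathbf r^* ),e_i(\mathbf r^* ))=(\tau_i^*,e_i^* )$, $i=1,2$, where $(\tau_1^*,e_1^* ),(\tau_2^*,e_2^* )$ is the saturation couple whose joining segment contains $(\tau,e)$; $\mathbf r^\#=(1-\alpha^*,1-\varphi^*,1-\xi^* )$ corresponds to the same couple with labels exchanged. The vectors $\overline{\mathbf r}=(\beta,\beta,\beta)$, $\beta\in\,]0,1[$, correspond to both phasic states equal to $(\tau,e)$. Lyapunov function: a differentiable function $G$ on the domain is called a Lyapunov function for the given set of equilibria if $G$ vanishes at those equilibria, $G>0$ at all other points of the domain, and $\frac{d}{dt}G(\mathbf r(t))\le0$ along every trajectory of the system. *)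

(* Defs.v *)
From Stdlib Require Import Reals.
From Coquelicot Require Import Coquelicot.
Open Scope R_scope.

Record vdw := Vdw {
  vdw_R : R;
  vdw_Cv : R;
  vdw_a : R;
  vdw_b : R;
  vdw_s0 : R
}.

(* A thermodynamic state is a pair (tau, e): specific volume, specific energy. *)

Definition Ds (k : vdw) (q : R * R) : Prop :=
  let (tau, e) := q in
  0 <= tau /\ 0 <= e /\ vdw_b k < tau /\ 0 < vdw_a k / tau + e.

Definition entropy (k : vdw) (q : R * R) : R :=
  let (tau, e) := q in
  vdw_Cv k * ln (vdw_a k / tau + e) + vdw_R k * ln (tau - vdw_b k) + vdw_s0 k.

Definition temperature (k : vdw) (q : R * R) : R :=
  let (tau, e) := q in / vdw_Cv k * (e + vdw_a k / tau).

Definition isotherm (k : vdw) (T tau : R) : R :=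
  vdw_R k * T / (tau - vdw_b k) - vdw_a k / tau ^ 2.

Definition pressure (k : vdw) (q : R * R) : R :=
  isotherm k (temperature k q) (fst q).

Definition chemical_potential (k : vdw) (q : R * R) : R :=
  snd q + pressure k q * fst q - temperature k q * entropy k q.

Definition segment_point (l : R) (q1 q2 : R * R) : R * R :=
  ((1 - l) * fst q1 + l * fst q2, (1 - l) * snd q1 + l * snd q2).

Definition concave_on (D : R * R -> Prop) (f : R * R -> R) : Prop :=
  forall (q1 q2 : R * R) (l : R), D q1 -> D q2 -> 0 <= l <= 1 ->
    (1 - l) * f q1 + l * f q2 <= f (segment_point l q1 q2).

(* [c] is the smallest concave function on [D] above [f]; its values off [D]
   are irrelevant. *)
Definition is_concave_hull (D : R * R -> Prop) (f c : R * R -> R) : Prop :=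
  concave_on D c /\
  (forall q, D q -> f q <= c q) /\
  (forall h : R * R -> R, concave_on D h -> (forall q, D q -> f q <= h q) ->
     forall q, D q -> c q <= h q).

Definition spinodal_bound (k : vdw) (tau : R) : R :=
  2 * vdw_a k * vdw_Cv k * (tau - vdw_b k) ^ 2 / (vdw_R k * tau ^ 3)
  - vdw_a k / tau.

Definition Z_spinodal (k : vdw) (q : R * R) : Prop :=
  Ds k q /\ snd q < spinodal_bound k (fst q).

(* [conc] stands for the concave hull of [entropy k] on [Ds k]. *)
Definition saturation_couple (k : vdw) (conc : R * R -> R) (q1 q2 : R * R)
  : Prop :=
  Ds k q1 /\ Ds k q2 /\ q1 <> q2 /\
  pressure k q1 = pressure k q2 /\
  temperature k q1 = temperature k q2 /\
  chemical_potential k q1 = chemical_potential k q2 /\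
  (forall l : R, 0 <= l <= 1 ->
     conc (segment_point l q1 q2) = (1 - l) * entropy k q1 + l * entropy k q2).

Definition saturation_dome (k : vdw) (conc : R * R -> R) (q : R * R) : Prop :=
  exists q1 q2, saturation_couple k conc q1 q2 /\ (q = q1 \/ q = q2).

(* The dome is the graph of the partial function [gs] with domain [dom].  A
   total function would be inconsistent: as the two states of a couple are
   distinct, the dome has no point above the critical volume. *)
Definition dome_graph (k : vdw) (conc : R * R -> R)
    (dom : R -> Prop) (gs : R -> R) : Prop :=
  forall tau e, saturation_dome k conc (tau, e) <-> dom tau /\ e = gs tau.

Definition has_critical_point (k : vdw) (T : R) : Prop :=
  0 < T /\
  exists tau, vdw_b k < tau /\
    is_derive_n (isotherm k T) 1 tau 0 /\ is_derive_n (isotherm k T) 2 tau 0.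

Definition is_critical_temperature (k : vdw) (Tc : R) : Prop :=
  unique (has_critical_point k) Tc.

Definition energy_at (k : vdw) (tau T : R) : R :=
  vdw_Cv k * T - vdw_a k / tau.

Definition Z_stable (k : vdw) (dom : R -> Prop) (gs : R -> R) (Tc : R)
    (q : R * R) : Prop :=
  let (tau, e) := q in
  Ds k q /\ dom tau /\ gs tau < e < energy_at k tau Tc.

(* A fraction vector is a triple (alpha, phi, xi). *)
Notation fractions := (R * R * R)%type.

Definition phase1 (tau e : R) (r : fractions) : R * R :=
  let '(alpha, phi, xi) := r in (alpha * tau / phi, xi * e / phi).

Definition phase2 (tau e : R) (r : fractions) : R * R :=
  let '(alpha, phi, xi) := r in
  ((1 - alpha) * tau / (1 - phi), (1 - xi) * e / (1 - phi)).

Definition admissible (k : vdw) (tau e : R) (r : fractions) : Prop :=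
  let '(alpha, phi, xi) := r in
  0 < alpha < 1 /\ 0 < phi < 1 /\ 0 < xi < 1 /\
  Ds k (phase1 tau e r) /\ Ds k (phase2 tau e r).

Definition vector_field (k : vdw) (tau e : R) (r : fractions) : fractions :=
  let '(alpha, phi, xi) := r in
  let q1 := phase1 tau e r in
  let q2 := phase2 tau e r in
  let p1 := pressure k q1 in
  let p2 := pressure k q2 in
  let T1 := temperature k q1 in
  let T2 := temperature k q2 in
  let mu1 := chemical_potential k q1 in
  let mu2 := chemical_potential k q2 in
  (alpha * (1 - alpha) * tau * (p1 / T1 - p2 / T2),
   phi * (1 - phi) * (mu2 / T2 - mu1 / T1),
   xi * (1 - xi) * e * (1 / T1 - 1 / T2)).

Definition mixture_entropy (k : vdw) (tau e : R) (r : fractions) : R :=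
  let '(alpha, phi, xi) := r in
  phi * entropy k (phase1 tau e r) + (1 - phi) * entropy k (phase2 tau e r).

Definition G_S (k : vdw) (conc : R * R -> R) (tau e : R) (r : fractions) : R :=
  - mixture_entropy k tau e r + conc (tau, e).

Definition G_I (k : vdw) (tau e : R) (r : fractions) : R :=
  - mixture_entropy k tau e r + entropy k (tau, e).

Definition exchange (r : fractions) : fractions :=
  let '(alpha, phi, xi) := r in (1 - alpha, 1 - phi, 1 - xi).

(* A solution of r' = F r staying in [D], on the open interval ]t0, t1[
   (possibly unbounded). *)
Definition is_trajectory (D : fractions -> Prop) (F : fractions -> fractions)
    (t0 t1 : Rbar) (r : R -> fractions) : Prop :=
  forall t : R, Rbar_lt t0 t -> Rbar_lt t t1 ->
    D (r t) /\ is_derive r t (F (r t)).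

Definition is_lyapunov (D : fractions -> Prop) (F : fractions -> fractions)
    (Eq : fractions -> Prop) (G : fractions -> R) : Prop :=
  (forall r, D r -> ex_filterdiff G (locally r)) /\
  (forall r, Eq r -> G r = 0) /\
  (forall r, D r -> ~ Eq r -> 0 < G r) /\
  (forall (t0 t1 : Rbar) (r : R -> fractions), is_trajectory D F t0 t1 r ->
     forall t : R, Rbar_lt t0 t -> Rbar_lt t t1 ->
       exists d : R, is_derive (fun u : R => G (r u)) t d /\ d <= 0).

(* Main.v *)
(* Along an isotherm, the entropy minus its tangent plane at a state is, up to a
   constant, f(t) = R ln(t - b) + a/(T t) - P t with P = p/T; off the isotherm it
   is smaller because ln x <= x - 1.  Equality of p, T, mu at the two states of a
   couple says that f has equal critical values there; by Rolle the cubic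
   numerator of f' has three roots, which gives its sign, so that the common
   tangent plane lies above the entropy and touches it exactly at the couple.
   This plane agrees with the concave hull on the segment, hence the sign of G_S
   and its zeros.  Above the dome, the gap f(t) - f(tau) is a temperature
   independent part plus a nonnegative multiple of a/T, so it decreases when the
   state (tau, e) is heated from the dome at fixed volume, hence the sign of G_I.
   Finally the vector field is (alpha(1-alpha) S_alpha, phi(1-phi) S_phi,
   xi(1-xi) S_xi), so the mixture entropy S increases along trajectories. *)
Require Import Defs.
From Stdlib Require Import Reals Lra Classical.
From Coquelicot Require Import Coquelicot.
Open Scope R_scope.

(** * The volume potential along an isotherm and its critical points *)

(** The parameter [th] stands for a/T and [P] for p/T, both frozen at a reference state. *)
Definition volume_potential (R0 b th P t : R) : R :=
  R0 * ln (t - b) + th / t - P * t.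

Definition volume_slope (R0 b th P t : R) : R :=
  R0 / (t - b) - th / t ^ 2 - P.

Lemma ln_lt_minus_1 (x : R) : 0 < x -> x <> 1 -> ln x < x - 1.
Proof.
intros Hx H1.
assert (Hl : ln x <> 0) by (intro H; apply H1; rewrite <- (exp_ln x Hx), H; apply exp_0).
pose proof (exp_ineq1 (ln x) Hl) as H.
rewrite exp_ln in H; lra.
Qed.

Lemma ln_le_minus_1 (x : R) : 0 < x -> ln x <= x - 1.
Proof.
intro Hx; destruct (Req_dec x 1) as [-> | H].
- rewrite ln_1; lra.
- apply Rlt_le, ln_lt_minus_1; assumption.
Qed.

Lemma volume_potential_MVT (R0 b th P t1 t2 : R) :
  0 <= b -> b < t1 -> t1 < t2 ->
  exists c, volume_potential R0 b th P t2 - volume_potential R0 b th P t1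
            = volume_slope R0 b th P c * (t2 - t1) /\ t1 < c < t2.
Proof.
intros Hb H1 H12.
apply MVT_cor2; [exact H12 |].
intros c Hc; apply is_derive_Reals.
unfold volume_potential, volume_slope.
auto_derive; [repeat split; lra | field; lra].
Qed.

(** Over the denominator t^2 (t - b) the slope has a cubic numerator with leading coefficient -P, so
    three roots factor it completely. *)
Lemma volume_slope_roots_P_pos (R0 b th P x y z : R) :
  0 < R0 -> 0 <= b -> b < x -> x < y -> y < z ->
  volume_slope R0 b th P x = 0 -> volume_slope R0 b th P y = 0 ->
  volume_slope R0 b th P z = 0 ->
  0 < P /\
  forall t, b < t ->
    volume_slope R0 b th P t
    = - P * ((t - x) * (t - y) * (t - z)) / (t ^ 2 * (t - b)).
Proof.
intros HR Hb Hx Hxy Hyz Sx Sy Sz.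
set (c := fun t => R0 * t ^ 2 - th * (t - b) - P * t ^ 2 * (t - b)).
assert (Hc : forall t, b < t -> volume_slope R0 b th P t = c t / (t ^ 2 * (t - b))).
{ intros t Ht; unfold volume_slope, c; field; lra. }
assert (Hz : forall t, b < t -> volume_slope R0 b th P t = 0 -> c t = 0).
{ intros t Ht H0.
  replace (c t) with (volume_slope R0 b th P t * (t ^ 2 * (t - b)))
    by (unfold volume_slope, c; field; lra).
  rewrite H0; ring. }
apply Hz in Sx; [| lra]; apply Hz in Sy; [| lra]; apply Hz in Sz; [| lra].
(* The divided differences of the cubic [c] at its roots vanish. *)
assert (Dxy : (R0 + P * b) * (x + y) - th - P * (x * x + x * y + y * y) = 0).
{ apply (Rmult_eq_reg_l (y - x)); [| lra].
  replace (_ * _) with (c y - c x) by (unfold c; ring). lra. }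
assert (Dxz : (R0 + P * b) * (x + z) - th - P * (x * x + x * z + z * z) = 0).
{ apply (Rmult_eq_reg_l (z - x)); [| lra].
  replace (_ * _) with (c z - c x) by (unfold c; ring). lra. }
(* The second divided difference compares the coefficients of t^2: the sum of the roots times P is
   R0 + P b. *)
assert (D : R0 + P * b = P * (x + y + z)).
{ apply Rminus_diag_uniq, (Rmult_eq_reg_l (z - y)); [| lra].
  replace (_ * _) with
    (((R0 + P * b) * (x + z) - th - P * (x * x + x * z + z * z))
     - ((R0 + P * b) * (x + y) - th - P * (x * x + x * y + y * y))) by ring.
  lra. }
(* P is positive because R0 = P (x + y + z - b), where both R0 and the second factor are
   positive. *)
split; [nra |].
intros t Ht; rewrite (Hc t Ht); f_equal.
assert (Eth : th = (R0 + P * b) * (x + y) - P * (x * x + x * y + y * y)) by lra.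
unfold c in *.
(* With [R0] and [th] eliminated only the constant term of the cubic is open, and [c] vanishing at a
   root fixes it. *)
replace R0 with (P * (x + y + z) - P * b) in * by lra.
nra.
Qed.

(** * Differentiability of the mixture entropy in the fractions *)

Lemma ex_filterdiff_Rmult {U : NormedModule R_AbsRing} (f g : U -> R) (x : U) :
  ex_filterdiff f (locally x) -> ex_filterdiff g (locally x) ->
  ex_filterdiff (fun u => f u * g u) (locally x).
Proof.
intros [lf Hf] [lg Hg]; eexists.
apply (filterdiff_mult_fct (K := R_AbsRing) f g x lf lg Rmult_comm Hf Hg).
Qed.

Lemma ex_filterdiff_derive {U : NormedModule R_AbsRing} (f : U -> R) (h : R -> R)
    (x : U) :
  ex_filterdiff f (locally x) -> ex_derive h (f x) ->
  ex_filterdiff (fun u => h (f u)) (locally x).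
Proof.
intros Hf Hh; apply ex_filterdiff_comp'; [exact Hf |].
apply ex_derive_filterdiff, Hh.
Qed.

Lemma ex_filterdiff_Rdiv {U : NormedModule R_AbsRing} (f g : U -> R) (x : U) :
  g x <> 0 -> ex_filterdiff f (locally x) -> ex_filterdiff g (locally x) ->
  ex_filterdiff (fun u => f u / g u) (locally x).
Proof.
intros H0 Hf Hg; apply ex_filterdiff_Rmult; [exact Hf |].
apply (ex_filterdiff_derive g Rinv); [exact Hg |].
auto_derive; exact H0.
Qed.

Lemma ex_filterdiff_Rplus {U : NormedModule R_AbsRing} (f g : U -> R) (x : U) :
  ex_filterdiff f (locally x) -> ex_filterdiff g (locally x) ->
  ex_filterdiff (fun u => f u + g u) (locally x).
Proof. exact (ex_filterdiff_plus_fct (V := R_NormedModule) f g). Qed.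

Lemma ex_filterdiff_1_minus {U : NormedModule R_AbsRing} (f : U -> R) (x : U) :
  ex_filterdiff f (locally x) -> ex_filterdiff (fun u => 1 - f u) (locally x).
Proof.
intro Hf; apply (ex_filterdiff_derive f (fun z => 1 - z)); [exact Hf |].
auto_derive; exact I.
Qed.

Lemma ex_filterdiff_entropy {U : NormedModule R_AbsRing} (k : vdw)
    (v w : U -> R) (x : U) :
  0 <= vdw_b k -> Ds k (v x, w x) ->
  ex_filterdiff v (locally x) -> ex_filterdiff w (locally x) ->
  ex_filterdiff (fun u => entropy k (v u, w u)) (locally x).
Proof.
intros Hb [H0 [_ [Hv He]]] Dv Dw; unfold entropy.
apply ex_filterdiff_Rplus; [| apply ex_filterdiff_const].
apply ex_filterdiff_Rplus.
- apply (ex_filterdiff_derive (fun u => vdw_a k / v u + w u)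
    (fun z => vdw_Cv k * ln z)).
  + apply ex_filterdiff_Rplus; [| exact Dw].
    apply ex_filterdiff_Rdiv; [lra | apply ex_filterdiff_const | exact Dv].
  + auto_derive; exact He.
- apply (ex_filterdiff_derive v (fun z => vdw_R k * ln (z - vdw_b k)));
    [exact Dv |].
  auto_derive; lra.
Qed.

(** The fractions are abstract real functions on a normed module, so that only rules for real-valued
    functions are involved; the projections of a triple are substituted later. *)
Lemma ex_filterdiff_mixture_entropy {U : NormedModule R_AbsRing} (k : vdw)
    (tau e : R) (al ph xi : U -> R) (x : U) :
  0 <= vdw_b k -> admissible k tau e (al x, ph x, xi x) ->
  ex_filterdiff al (locally x) -> ex_filterdiff ph (locally x) ->
  ex_filterdiff xi (locally x) ->
  ex_filterdiff (fun u => mixture_entropy k tau e (al u, ph u, xi u)) (locally x).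
Proof.
intros Hb [_ [Hph [_ [D1 D2]]]] Dal Dph Dxi.
assert (Dc : forall c : R, ex_filterdiff (fun _ : U => c) (locally x))
  by (intro c; apply ex_filterdiff_const).
pose proof (ex_filterdiff_1_minus _ _ Dal) as Dal'.
pose proof (ex_filterdiff_1_minus _ _ Dph) as Dph'.
pose proof (ex_filterdiff_1_minus _ _ Dxi) as Dxi'.
assert (Nph : ph x <> 0) by lra.
assert (Nph' : 1 - ph x <> 0) by lra.
assert (Dq : forall (f g : U -> R) (c : R), g x <> 0 ->
  ex_filterdiff f (locally x) -> ex_filterdiff g (locally x) ->
  ex_filterdiff (fun u => f u * c / g u) (locally x)).
{ intros f g c Hg Df Dg; apply (ex_filterdiff_Rdiv (fun u => f u * c)); try assumption.
  apply (ex_filterdiff_Rmult f (fun _ => c)); [exact Df | apply Dc]. }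
unfold mixture_entropy, phase1, phase2.
apply (ex_filterdiff_Rplus
  (fun u => ph u * entropy k (al u * tau / ph u, xi u * e / ph u))
  (fun u => (1 - ph u) * entropy k ((1 - al u) * tau / (1 - ph u),
                                    (1 - xi u) * e / (1 - ph u)))).
- apply (ex_filterdiff_Rmult ph); [exact Dph |].
  apply ex_filterdiff_entropy; [exact Hb | exact D1 | |]; apply Dq; assumption.
- apply (ex_filterdiff_Rmult (fun u => 1 - ph u)); [exact Dph' |].
  apply (ex_filterdiff_entropy k (fun u => (1 - al u) * tau / (1 - ph u))
    (fun u => (1 - xi u) * e / (1 - ph u))); [exact Hb | exact D2 | |].
  + apply (Dq (fun u => 1 - al u) (fun u => 1 - ph u)); assumption.
  + apply (Dq (fun u => 1 - xi u) (fun u => 1 - ph u)); assumption.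
Qed.

(** Rewrites a function that matches on a triple as a function of the three projections, where the
    preceding lemmas apply. *)
Lemma ex_filterdiff_fractions (G : R * R * R -> R) (r : R * R * R) :
  ex_filterdiff (fun u : R * R * R => G (fst (fst u), snd (fst u), snd u))
    (locally r) ->
  ex_filterdiff G (locally r).
Proof.
apply ex_filterdiff_ext; intros [[? ?] ?]; reflexivity.
Qed.

(** * Two critical points at the same level are the global maxima *)

(** With r the third root of the slope, the potential increases up to t1, decreases on [t1, r],
    increases on [r, t2] and decreases afterwards. *)
Lemma volume_potential_max (R0 b th P t1 t2 t : R) :
  0 < R0 -> 0 <= b -> b < t1 -> t1 < t2 -> b < t ->
  volume_slope R0 b th P t1 = 0 -> volume_slope R0 b th P t2 = 0 ->
  volume_potential R0 b th P t1 = volume_potential R0 b th P t2 ->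
  t <> t1 -> t <> t2 ->
  volume_potential R0 b th P t < volume_potential R0 b th P t1.
Proof.
intros HR Hb H1 H12 Ht S1 S2 E N1 N2.
(* Rolle: equal values at t1 and t2 give a root r of the slope between them. *)
destruct (volume_potential_MVT R0 b th P t1 t2 Hb H1 H12) as [r [Er Hr]].
assert (Sr : volume_slope R0 b th P r = 0).
{ apply (Rmult_eq_reg_r (t2 - t1)); lra. }
destruct (volume_slope_roots_P_pos R0 b th P t1 r t2) as [HP HS]; try lra.
assert (Hden : forall c, b < c -> 0 < c ^ 2 * (c - b)).
{ intros c Hc; apply Rmult_lt_0_compat; [apply pow_lt |]; lra. }
assert (Hpos : forall c, b < c -> (c - t1) * (c - r) * (c - t2) < 0 ->
  0 < volume_slope R0 b th P c).
{ intros c Hc Hn; rewrite (HS c Hc); apply Rdiv_lt_0_compat; [nra | apply Hden, Hc]. }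
assert (Hneg : forall c, b < c -> 0 < (c - t1) * (c - r) * (c - t2) ->
  volume_slope R0 b th P c < 0).
{ intros c Hc Hn; rewrite (HS c Hc); apply Rdiv_neg_pos; [nra | apply Hden, Hc]. }
(* In each of the four intervals t is compared with the maximum that can be reached without crossing
   r. *)
destruct (Rlt_le_dec t t1) as [L1 | L1].
{ destruct (volume_potential_MVT R0 b th P t t1) as [c [Ec Hc]]; try lra.
  assert (0 < volume_slope R0 b th P c); [apply Hpos; [lra |] | nra].
  assert (0 < (c - t1) * (c - r)) by nra. nra. }
destruct (Rlt_le_dec t2 t) as [L2 | L2].
{ destruct (volume_potential_MVT R0 b th P t2 t) as [c [Ec Hc]]; try lra.
  assert (volume_slope R0 b th P c < 0); [apply Hneg; [lra |] | nra].
  assert (0 < (c - t1) * (c - r)) by nra. nra. }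
destruct (Rle_lt_dec t r) as [L | L].
- destruct (volume_potential_MVT R0 b th P t1 t) as [c [Ec Hc]]; try lra.
  assert (volume_slope R0 b th P c < 0); [apply Hneg; [lra |] | nra].
  assert ((c - t1) * (c - r) < 0) by nra. nra.
- destruct (volume_potential_MVT R0 b th P t t2) as [c [Ec Hc]]; try lra.
  assert (0 < volume_slope R0 b th P c); [apply Hpos; [lra |] | nra].
  assert (0 < (c - t1) * (c - r)) by nra. nra.
Qed.

(** * Tangent planes of the entropy in the coordinates volume and temperature *)

(** The first-order expansion of the entropy at [q], whose gradient there is (p/T, 1/T). *)
Definition tangent_plane (k : vdw) (q y : R * R) : R :=
  entropy k q + (snd y - snd q) / temperature k q
  + pressure k q / temperature k q * (fst y - fst q).

Definition isothermal_potential (k : vdw) (q : R * R) (t : R) : R :=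
  volume_potential (vdw_R k) (vdw_b k) (vdw_a k / temperature k q)
    (pressure k q / temperature k q) t.

Section VanDerWaals.

Variable k : vdw.
Hypothesis hR : 0 < vdw_R k.
Hypothesis hCv : 0 < vdw_Cv k.
Hypothesis ha : 0 <= vdw_a k.
Hypothesis hb : 0 <= vdw_b k.

Lemma Ds_volume (q : R * R) : Ds k q -> vdw_b k < fst q.
Proof. destruct q as [t e]; simpl; tauto. Qed.

Lemma temperature_pos (q : R * R) : Ds k q -> 0 < temperature k q.
Proof.
destruct q as [t e]; intros [_ [_ [_ H]]]; simpl.
apply Rmult_lt_0_compat; [apply Rinv_0_lt_compat |]; lra.
Qed.

(** At fixed volume the temperature is affine in the energy with slope 1/C_v, so volume and
    temperature are coordinates. *)
Lemma Ds_eq (q y : R * R) : Ds k q -> Ds k y ->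
  temperature k q = temperature k y -> fst q = fst y -> q = y.
Proof.
destruct q as [t e], y as [t' e']; simpl.
intros _ _ ET Et; subst t'; f_equal.
apply Rmult_eq_reg_l in ET; [lra |].
apply Rgt_not_eq, Rinv_0_lt_compat, hCv.
Qed.

(** In volume and temperature the entropy separates into a sum; this is what decouples the gap to a
    tangent plane. *)
Lemma entropy_temperature (q : R * R) : Ds k q ->
  entropy k q = vdw_Cv k * ln (vdw_Cv k) + vdw_Cv k * ln (temperature k q)
                + vdw_R k * ln (fst q - vdw_b k) + vdw_s0 k.
Proof.
intro Hq; pose proof (temperature_pos q Hq) as HT.
destruct q as [t e]; unfold entropy, fst.
rewrite <- Rmult_plus_distr_l, <- ln_mult by assumption.
do 4 f_equal; simpl; field; destruct Hq as [? [? [? ?]]]; lra.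
Qed.

Lemma energy_temperature (q : R * R) : Ds k q ->
  snd q = vdw_Cv k * temperature k q - vdw_a k / fst q.
Proof.
destruct q as [t e]; intros [? [? [? ?]]]; simpl; field; lra.
Qed.

(** This is the equation of state divided by T: every state is a critical point of its own
    potential. *)
Lemma isothermal_slope (q : R * R) : Ds k q ->
  volume_slope (vdw_R k) (vdw_b k) (vdw_a k / temperature k q)
    (pressure k q / temperature k q) (fst q) = 0.
Proof.
intro Hq; pose proof (temperature_pos q Hq); pose proof (Ds_volume q Hq).
unfold volume_slope, pressure, isotherm; field; lra.
Qed.

(** Since e = C_v T - a/tau, the energy term of the plane contributes the linear part in the
    temperature ratio and the part a/(T t) of the potential. *)
Lemma entropy_minus_tangent_plane (q y : R * R) : Ds k q -> Ds k y ->
  entropy k y - tangent_plane k q y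
  = vdw_Cv k * (ln (temperature k y / temperature k q)
                - (temperature k y / temperature k q - 1))
    + (isothermal_potential k q (fst y) - isothermal_potential k q (fst q)).
Proof.
intros Hq Hy.
pose proof (temperature_pos q Hq); pose proof (Ds_volume q Hq).
pose proof (temperature_pos y Hy); pose proof (Ds_volume y Hy).
unfold tangent_plane, isothermal_potential, volume_potential.
rewrite (entropy_temperature q), (entropy_temperature y) by assumption.
rewrite (energy_temperature q), (energy_temperature y) by assumption.
rewrite ln_div by assumption.
field; lra.
Qed.

Lemma tangent_plane_le (q y : R * R) : Ds k q -> Ds k y ->
  isothermal_potential k q (fst y) <= isothermal_potential k q (fst q) ->
  entropy k y <= tangent_plane k q y.
Proof.
intros Hq Hy Hle.
pose proof (entropy_minus_tangent_plane q y Hq Hy).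
assert (ln (temperature k y / temperature k q)
        <= temperature k y / temperature k q - 1).
{ apply ln_le_minus_1, Rdiv_lt_0_compat; apply temperature_pos; assumption. }
nra.
Qed.

Lemma tangent_plane_lt (q y : R * R) : Ds k q -> Ds k y ->
  isothermal_potential k q (fst y) <= isothermal_potential k q (fst q) ->
  temperature k y <> temperature k q \/
  isothermal_potential k q (fst y) < isothermal_potential k q (fst q) ->
  entropy k y < tangent_plane k q y.
Proof.
intros Hq Hy Hle Hlt.
pose proof (entropy_minus_tangent_plane q y Hq Hy).
pose proof (temperature_pos q Hq); pose proof (temperature_pos y Hy).
assert (0 < temperature k y / temperature k q) by (apply Rdiv_lt_0_compat; assumption).
destruct Hlt as [Hne | Hlt].
- assert (ln (temperature k y / temperature k q)
          < temperature k y / temperature k q - 1); [| nra].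
  apply ln_lt_minus_1; [assumption |].
  intro E; apply Hne, (Rmult_eq_reg_r (/ temperature k q)).
  + unfold Rdiv in E; rewrite E; field; lra.
  + apply Rinv_neq_0_compat; lra.
- pose proof (ln_le_minus_1 (temperature k y / temperature k q)); nra.
Qed.

Lemma tangent_plane_self (q : R * R) : tangent_plane k q q = entropy k q.
Proof. unfold tangent_plane, Rdiv; ring. Qed.

Lemma tangent_plane_mixture (q x y1 y2 : R * R) (l : R) :
  x = segment_point l y1 y2 ->
  tangent_plane k q x
  = (1 - l) * tangent_plane k q y1 + l * tangent_plane k q y2.
Proof.
intros ->; unfold tangent_plane, segment_point, Rdiv; simpl; ring.
Qed.

(** Two states with the same p and T share one potential, so equality of their chemical potentials
    becomes equality of its values. *)
Lemma chemical_potential_isothermal (q : R * R) : Ds k q ->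
  chemical_potential k q / temperature k q
  = vdw_Cv k - vdw_Cv k * ln (vdw_Cv k) - vdw_Cv k * ln (temperature k q)
    - vdw_s0 k - isothermal_potential k q (fst q).
Proof.
intro Hq; pose proof (temperature_pos q Hq); pose proof (Ds_volume q Hq).
unfold chemical_potential, isothermal_potential, volume_potential.
rewrite (entropy_temperature q), (energy_temperature q) by assumption.
field; lra.
Qed.

(** * The common tangent plane of a saturation couple *)

Section Couple.

Variables (conc : R * R -> R) (q1 q2 : R * R).
Hypothesis Hc : saturation_couple k conc q1 q2.

Lemma couple_volume_neq : fst q1 <> fst q2.
Proof.
destruct Hc as [D1 [D2 [N [_ [ET _]]]]]; intro E; apply N, Ds_eq; assumption.
Qed.

Lemma couple_sym_potential :
  isothermal_potential k q2 = isothermal_potential k q1.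
Proof.
destruct Hc as [_ [_ [_ [Ep [ET _]]]]]; unfold isothermal_potential.
rewrite Ep, ET; reflexivity.
Qed.

Lemma couple_potential_eq :
  isothermal_potential k q1 (fst q2) = isothermal_potential k q1 (fst q1).
Proof.
destruct Hc as [D1 [D2 [_ [Ep [ET [Em _]]]]]].
pose proof (chemical_potential_isothermal q1 D1) as E1.
pose proof (chemical_potential_isothermal q2 D2) as E2.
rewrite couple_sym_potential, <- ET, <- Em in E2; lra.
Qed.

Lemma couple_potential_lt (t : R) : vdw_b k < t -> t <> fst q1 -> t <> fst q2 ->
  isothermal_potential k q1 t < isothermal_potential k q1 (fst q1).
Proof.
intros Ht N1 N2.
pose proof couple_volume_neq as N; pose proof couple_potential_eq as E.
destruct Hc as [D1 [D2 [_ [Ep [ET _]]]]].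
pose proof (Ds_volume q1 D1); pose proof (Ds_volume q2 D2).
pose proof (isothermal_slope q1 D1) as S1.
pose proof (isothermal_slope q2 D2) as S2; rewrite <- Ep, <- ET in S2.
unfold isothermal_potential in *.
(* The maximum lemma wants ordered volumes; in the reverse order it bounds by the value at [q2],
   which equals that at [q1]. *)
destruct (Rlt_le_dec (fst q1) (fst q2)).
- apply volume_potential_max with (fst q2); auto.
- rewrite <- E; apply volume_potential_max with (fst q1); auto; lra.
Qed.

Lemma couple_potential_le (t : R) : vdw_b k < t ->
  isothermal_potential k q1 t <= isothermal_potential k q1 (fst q1).
Proof.
intro Ht; pose proof couple_potential_eq.
destruct (Req_dec t (fst q1)) as [-> | N1]; [lra |].
destruct (Req_dec t (fst q2)) as [-> | N2]; [lra |].
apply Rlt_le, couple_potential_lt; assumption.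
Qed.

Lemma couple_tangent_plane_le (y : R * R) : Ds k y ->
  entropy k y <= tangent_plane k q1 y.
Proof.
intro Hy; destruct Hc as [D1 _].
apply tangent_plane_le; try assumption.
apply couple_potential_le, Ds_volume, Hy.
Qed.

(** Contact forces both parts of the gap to vanish: the temperature is that of the couple and the
    volume is one of the two maxima. *)
Lemma couple_tangent_plane_eq (y : R * R) : Ds k y ->
  entropy k y = tangent_plane k q1 y -> y = q1 \/ y = q2.
Proof.
intros Hy E; destruct Hc as [D1 [D2 [_ [_ [ET _]]]]].
pose proof (couple_potential_le (fst y) (Ds_volume y Hy)) as Hle.
destruct (Req_dec (temperature k y) (temperature k q1)) as [T1 | T1].
2: { pose proof (tangent_plane_lt q1 y D1 Hy Hle (or_introl T1)); lra. }
destruct (Req_dec (fst y) (fst q1)) as [F1 | F1].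
{ left; apply Ds_eq; assumption. }
destruct (Req_dec (fst y) (fst q2)) as [F2 | F2].
{ right; apply Ds_eq; [| | rewrite T1 |]; assumption. }
pose proof (couple_potential_lt (fst y) (Ds_volume y Hy) F1 F2) as Hlt.
pose proof (tangent_plane_lt q1 y D1 Hy Hle (or_intror Hlt)); lra.
Qed.

(** Both parts of the gap vanish at [q2]: the temperature ratio is 1 and the potential values
    agree. *)
Lemma couple_tangent_plane_right : tangent_plane k q1 q2 = entropy k q2.
Proof.
destruct Hc as [D1 [D2 [_ [_ [ET _]]]]].
pose proof (entropy_minus_tangent_plane q1 q2 D1 D2) as H.
pose proof (temperature_pos q1 D1).
rewrite couple_potential_eq, <- ET in H.
replace (temperature k q1 / temperature k q1) with 1 in H by (field; lra).
rewrite ln_1 in H; lra.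
Qed.

(** On the segment the hull interpolates the two endpoint entropies, by the last clause of a couple;
    the affine plane has the same endpoint values. *)
Lemma couple_hull_tangent_plane (l : R) (x : R * R) : 0 <= l <= 1 ->
  x = segment_point l q1 q2 -> conc x = tangent_plane k q1 x.
Proof.
intros Hl E; rewrite (tangent_plane_mixture q1 x q1 q2 l E).
rewrite tangent_plane_self, couple_tangent_plane_right, E.
apply Hc, Hl.
Qed.

End Couple.

(** * Stability above the dome *)

Lemma saturation_couple_sym (conc : R * R -> R) (q1 q2 : R * R) :
  saturation_couple k conc q1 q2 -> saturation_couple k conc q2 q1.
Proof.
intros [D1 [D2 [N [Ep [ET [Em Hs]]]]]]; repeat split; auto.
intros l Hl.
replace (segment_point l q2 q1) with (segment_point (1 - l) q1 q2)
  by (unfold segment_point; f_equal; ring).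
rewrite Hs by lra; ring.
Qed.

(* The logarithmic part of the gap does not depend on the temperature and the
   attractive part decreases with it: at fixed volume, heating preserves
   stability. *)
Lemma isothermal_potential_gap (q : R * R) (t : R) :
  Ds k q -> vdw_b k < t ->
  isothermal_potential k q t - isothermal_potential k q (fst q)
  = vdw_R k * (ln (t - vdw_b k) - ln (fst q - vdw_b k)
               - (t - fst q) / (fst q - vdw_b k))
    + vdw_a k / temperature k q * ((t - fst q) ^ 2 / (fst q ^ 2 * t)).
Proof.
intros Hq Ht; pose proof (temperature_pos q Hq); pose proof (Ds_volume q Hq).
unfold isothermal_potential, volume_potential, pressure, isotherm.
field; lra.
Qed.

(** For a = 0 the slope R/(t - b) - P has at most one zero, so the two states would have equal
    volumes. *)
Lemma couple_attraction_pos (conc : R * R -> R) (q1 q2 : R * R) :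
  saturation_couple k conc q1 q2 -> 0 < vdw_a k.
Proof.
intro Hc; pose proof (couple_volume_neq conc q1 q2 Hc) as N.
destruct Hc as [D1 [D2 [_ [Ep [ET _]]]]].
destruct ha as [Hpos | H0]; [exact Hpos | exfalso; apply N].
pose proof (isothermal_slope q1 D1) as S1.
pose proof (isothermal_slope q2 D2) as S2; rewrite <- Ep, <- ET in S2.
pose proof (Ds_volume q1 D1); pose proof (Ds_volume q2 D2).
unfold volume_slope in S1, S2; rewrite <- H0 in S1, S2.
assert (E : vdw_R k / (fst q1 - vdw_b k) = vdw_R k / (fst q2 - vdw_b k)).
{ unfold Rdiv in *; rewrite !Rmult_0_l in *; lra. }
apply Rmult_eq_reg_l in E; [| lra].
apply Rinv_eq_reg in E; lra.
Qed.

Lemma stable_above_couple (conc : R * R -> R) (q1 q2 x y : R * R) :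
  saturation_couple k conc q1 q2 -> Ds k x -> fst x = fst q1 ->
  temperature k q1 < temperature k x ->
  Ds k y -> y <> x -> entropy k y < tangent_plane k x y.
Proof.
intros Hc Hx Ex HT Hy N.
pose proof (couple_attraction_pos conc q1 q2 Hc).
pose proof (couple_potential_le conc q1 q2 Hc (fst y) (Ds_volume y Hy)) as Hq.
destruct Hc as [D1 _].
pose proof (temperature_pos q1 D1); pose proof (Ds_volume q1 D1).
(* At equal volumes the strict inequality comes from the temperatures. *)
destruct (Req_dec (fst y) (fst x)) as [Ef | Nf].
{ apply tangent_plane_lt; auto; rewrite Ef; [apply Rle_refl | left].
  intro ET; apply N, Ds_eq; assumption. }
(* At a common volume the gaps of [q1] and [x] differ only in the factor a/T, strictly smaller at
   the hotter state [x]; the gap of [q1] is already nonpositive. *)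
assert (isothermal_potential k x (fst y) < isothermal_potential k x (fst x)).
{ pose proof (isothermal_potential_gap q1 (fst y) D1 (Ds_volume y Hy)) as G1.
  pose proof (isothermal_potential_gap x (fst y) Hx (Ds_volume y Hy)) as Gx.
  pose proof (Ds_volume y Hy).
  rewrite Ex in *.
  assert (vdw_a k / temperature k x < vdw_a k / temperature k q1).
  { apply Rmult_lt_compat_l; [assumption |].
    apply Rinv_lt_contravar; [apply Rmult_lt_0_compat; lra | assumption]. }
  assert (0 < (fst y - fst q1) ^ 2 / (fst q1 ^ 2 * fst y)).
  { apply Rdiv_lt_0_compat; [apply pow2_gt_0; lra |].
    apply Rmult_lt_0_compat; [apply pow_lt |]; lra. }
  nra. }
apply tangent_plane_lt; auto; apply Rlt_le; assumption.
Qed.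

(** * The mixture entropy: bound by a plane and growth along trajectories *)

(** The state (tau, e) is the mean of the phases with weights phi and 1 - phi, and the plane is
    affine. Both weights are positive, so equality of the means forces equality in each phase. *)
Lemma mixture_le_tangent_plane (tau e : R) (q : R * R) (r : R * R * R) :
  admissible k tau e r ->
  entropy k (phase1 tau e r) <= tangent_plane k q (phase1 tau e r) ->
  entropy k (phase2 tau e r) <= tangent_plane k q (phase2 tau e r) ->
  mixture_entropy k tau e r <= tangent_plane k q (tau, e) /\
  (mixture_entropy k tau e r = tangent_plane k q (tau, e) ->
   entropy k (phase1 tau e r) = tangent_plane k q (phase1 tau e r) /\
   entropy k (phase2 tau e r) = tangent_plane k q (phase2 tau e r)).
Proof.
destruct r as [[al ph] xi]; intros [Hal [Hph [Hxi _]]] H1 H2.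
rewrite (tangent_plane_mixture q (tau, e) (phase1 tau e (al, ph, xi))
  (phase2 tau e (al, ph, xi)) (1 - ph)).
2: { unfold segment_point; simpl; f_equal; field; lra. }
unfold mixture_entropy; split; [| intro E; split]; nra.
Qed.

(** [auto_derive] leaves [Derive] terms for abstract functions; they are replaced by the value known
    from [H]. *)
Ltac rewrite_derive H :=
  match type of H with is_derive _ ?x ?l =>
    repeat match goal with |- context [Derive ?g x] =>
      replace (Derive g x) with l by (symmetry; apply is_derive_unique, H)
    end
  end.

Lemma is_derive_convex_combination (l f g : R -> R) (t dl df dg : R) :
  is_derive l t dl -> is_derive f t df -> is_derive g t dg ->
  is_derive (fun u => l u * f u + (1 - l u) * g u) t
    (dl * (f t - g t) + l t * df + (1 - l t) * dg).
Proof.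
intros Hl Hf Hg; auto_derive.
- repeat split; eexists; eassumption.
- rewrite_derive Hl; rewrite_derive Hf; rewrite_derive Hg; ring.
Qed.

Lemma is_derive_entropy (v w : R -> R) (t dv dw : R) :
  Ds k (v t, w t) -> is_derive v t dv -> is_derive w t dw ->
  is_derive (fun u => entropy k (v u, w u)) t
    (pressure k (v t, w t) / temperature k (v t, w t) * dv
     + dw / temperature k (v t, w t)).
Proof.
intros [H0 [_ [Hb He]]] Hv Hw; unfold entropy.
auto_derive.
- repeat split; try (eexists; eassumption); lra.
- rewrite_derive Hv; rewrite_derive Hw.
  unfold pressure, isotherm, temperature, fst; field; repeat split; try lra.
  (* The remaining condition of [field] is that a + w v, the numerator of the positive quantity a/v
     + w, is nonzero. *)
  enough (vdw_a k / v t + w t = (vdw_a k + w t * v t) / v t) as E.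
  { intro Z; rewrite E in He; rewrite Rplus_comm in Z.
    rewrite Z in He; unfold Rdiv in He; lra. }
  field; lra.
Qed.

(** Each component of the field is a positive weight times the matching partial derivative, so the
    derivative is a weighted sum of squares. *)
Lemma is_derive_mixture_entropy (tau e : R) (r : R -> R * R * R) (t : R) :
  admissible k tau e (r t) ->
  is_derive r t (vector_field k tau e (r t)) ->
  exists d, is_derive (fun u => mixture_entropy k tau e (r u)) t d /\ 0 <= d.
Proof.
intros Ha Hr.
set (al := fun u => fst (fst (r u))); set (ph := fun u => snd (fst (r u))).
set (xi := fun u => snd (r u)).
set (F := vector_field k tau e (r t)) in Hr.
assert (Hfst : is_derive (fun u => fst (r u)) t (fst F)).
{ apply (filterdiff_comp' r fst t (fun y => scal y F) fst Hr).
  apply filterdiff_linear, is_linear_fst. }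
assert (Hxi : is_derive xi t (snd F)).
{ apply (filterdiff_comp' r snd t (fun y => scal y F) snd Hr).
  apply filterdiff_linear, is_linear_snd. }
assert (Hal : is_derive al t (fst (fst F))).
{ apply (filterdiff_comp' _ fst t (fun y => scal y (fst F)) fst Hfst).
  apply filterdiff_linear, is_linear_fst. }
assert (Hph : is_derive ph t (snd (fst F))).
{ apply (filterdiff_comp' _ snd t (fun y => scal y (fst F)) snd Hfst).
  apply filterdiff_linear, is_linear_snd. }
assert (Er : forall u, r u = (al u, ph u, xi u)).
{ intro u; unfold al, ph, xi; destruct (r u) as [[? ?] ?]; reflexivity. }
clearbody al ph xi.
subst F; rewrite Er in *.
destruct Ha as [Ia [Ip [Ix [D1 D2]]]].
pose proof (temperature_pos _ D1) as T1; pose proof (temperature_pos _ D2) as T2.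
set (F := vector_field k tau e (al t, ph t, xi t)) in *.
assert (E1 : is_derive (fun u => entropy k (phase1 tau e (al u, ph u, xi u))) t
  (pressure k (phase1 tau e (al t, ph t, xi t))
   / temperature k (phase1 tau e (al t, ph t, xi t))
   * ((fst (fst F) * ph t - al t * snd (fst F)) * tau / (ph t) ^ 2)
   + (snd F * ph t - xi t * snd (fst F)) * e / (ph t) ^ 2
     / temperature k (phase1 tau e (al t, ph t, xi t)))).
{ apply (is_derive_entropy (fun u => al u * tau / ph u)
    (fun u => xi u * e / ph u)); [exact D1 | |];
  auto_derive; try (repeat split; try (eexists; eassumption); lra).
  all: rewrite_derive Hal; rewrite_derive Hph; rewrite_derive Hxi; field; lra. }
assert (E2 : is_derive (fun u => entropy k (phase2 tau e (al u, ph u, xi u))) t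
  (pressure k (phase2 tau e (al t, ph t, xi t))
   / temperature k (phase2 tau e (al t, ph t, xi t))
   * ((- fst (fst F) * (1 - ph t) + (1 - al t) * snd (fst F)) * tau / (1 - ph t) ^ 2)
   + (- snd F * (1 - ph t) + (1 - xi t) * snd (fst F)) * e / (1 - ph t) ^ 2
     / temperature k (phase2 tau e (al t, ph t, xi t)))).
{ apply (is_derive_entropy (fun u => (1 - al u) * tau / (1 - ph u))
    (fun u => (1 - xi u) * e / (1 - ph u))); [exact D2 | |];
  auto_derive; try (repeat split; try (eexists; eassumption); lra).
  all: rewrite_derive Hal; rewrite_derive Hph; rewrite_derive Hxi; field; lra. }
set (q1 := phase1 tau e (al t, ph t, xi t)) in *.
set (q2 := phase2 tau e (al t, ph t, xi t)) in *.
(* [X], [Y], [Z] are the partial derivatives of the mixture entropy in alpha, phi and xi. *)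
set (X := tau * (pressure k q1 / temperature k q1
                 - pressure k q2 / temperature k q2)).
set (Y := chemical_potential k q2 / temperature k q2
          - chemical_potential k q1 / temperature k q1).
set (Z := e * (1 / temperature k q1 - 1 / temperature k q2)).
exists (al t * (1 - al t) * X ^ 2 + ph t * (1 - ph t) * Y ^ 2
        + xi t * (1 - xi t) * Z ^ 2); split.
- apply (is_derive_ext (fun u =>
    ph u * entropy k (phase1 tau e (al u, ph u, xi u))
    + (1 - ph u) * entropy k (phase2 tau e (al u, ph u, xi u)))).
  { intro u; rewrite Er; reflexivity. }
  pose proof (is_derive_convex_combination _ _ _ _ _ _ _ Hph E1 E2) as H.
  cbv beta in H; fold q1 q2 in H.
  match type of H with is_derive _ _ ?d =>
    match goal with |- is_derive _ _ ?d' => replace d' with d; [exact H |] end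
  end.
  change (fst (fst F)) with (al t * (1 - al t) * tau
    * (pressure k q1 / temperature k q1 - pressure k q2 / temperature k q2)).
  change (snd (fst F)) with (ph t * (1 - ph t) * Y).
  change (snd F) with (xi t * (1 - xi t) * e
    * (1 / temperature k q1 - 1 / temperature k q2)).
  unfold X, Y, Z, chemical_potential.
  change (fst q1) with (al t * tau / ph t).
  change (snd q1) with (xi t * e / ph t).
  change (fst q2) with ((1 - al t) * tau / (1 - ph t)).
  change (snd q2) with ((1 - xi t) * e / (1 - ph t)).
  set (s1 := entropy k q1); set (s2 := entropy k q2).
  set (p1 := pressure k q1); set (p2 := pressure k q2).
  set (h1 := temperature k q1) in *; set (h2 := temperature k q2) in *.
  (* What is left is a rational identity, valid for any entropies and pressures and any nonzero
     temperatures. *)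
  clearbody s1 s2 p1 p2 h1 h2.
  field; lra.
- repeat apply Rplus_le_le_0_compat; apply Rmult_le_pos; try apply pow2_ge_0; nra.
Qed.

(** Common reduction for [G_S] and [G_I]: it remains to show that c is the maximum of the mixture
    entropy and is reached exactly on [Eq]. *)
Lemma is_lyapunov_minus_mixture_entropy (tau e c : R)
    (Eq : R * R * R -> Prop) :
  (forall r, Eq r -> mixture_entropy k tau e r = c) ->
  (forall r, admissible k tau e r -> ~ Eq r -> mixture_entropy k tau e r < c) ->
  is_lyapunov (admissible k tau e) (vector_field k tau e) Eq
    (fun r => - mixture_entropy k tau e r + c).
Proof.
intros H0 Hlt; repeat split.
- intros r Hr.
  apply (ex_filterdiff_derive (mixture_entropy k tau e) (fun z => - z + c)).
  + assert (Dfst : ex_filterdiff (fun u : R * R * R => fst u) (locally r))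
      by apply ex_filterdiff_linear, is_linear_fst.
    apply ex_filterdiff_fractions.
    apply (ex_filterdiff_mixture_entropy k tau e (fun u : R * R * R => fst (fst u))
      (fun u => snd (fst u)) (fun u => snd u)); try assumption.
    * destruct r as [[? ?] ?]; exact Hr.
    * apply (ex_filterdiff_comp' (fun u : R * R * R => fst u)
        (fun v : R * R => fst v) r Dfst).
      apply ex_filterdiff_linear, is_linear_fst.
    * apply (ex_filterdiff_comp' (fun u : R * R * R => fst u)
        (fun v : R * R => snd v) r Dfst).
      apply ex_filterdiff_linear, is_linear_snd.
    * apply ex_filterdiff_linear, is_linear_snd.
  + auto_derive; exact I.
- intros r Hr; rewrite (H0 r Hr); ring.
- intros r Hr HN; specialize (Hlt r Hr HN); lra.
- intros t0 t1 r Htraj t Ht0 Ht1.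
  destruct (Htraj t Ht0 Ht1) as [Ha Hd].
  destruct (is_derive_mixture_entropy tau e r t Ha Hd) as [d [Hm Hpos]].
  exists (- d); split; [| lra].
  set (m := fun u => mixture_entropy k tau e (r u)).
  change (is_derive m t d) in Hm.
  change (is_derive (fun u => - m u + c) t (- d)); clearbody m.
  auto_derive; [exists d; exact Hm |].
  rewrite_derive Hm; ring.
Qed.

(** * Exchange of labels and recovery of the fractions from the phases *)

Lemma mixture_entropy_exchange (tau e : R) (r : R * R * R) :
  mixture_entropy k tau e (exchange r) = mixture_entropy k tau e r.
Proof.
destruct r as [[al ph] xi]; unfold mixture_entropy, exchange, phase1, phase2.
replace (1 - (1 - al)) with al by ring.
replace (1 - (1 - ph)) with ph by ring.
replace (1 - (1 - xi)) with xi by ring.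
ring.
Qed.

Lemma phase1_exchange (tau e : R) (r : R * R * R) :
  phase1 tau e (exchange r) = phase2 tau e r.
Proof. destruct r as [[al ph] xi]; reflexivity. Qed.

Lemma phase2_exchange (tau e : R) (r : R * R * R) :
  phase2 tau e (exchange r) = phase1 tau e r.
Proof.
destruct r as [[al ph] xi]; unfold exchange, phase1, phase2.
f_equal; f_equal; ring.
Qed.

Lemma admissible_exchange (tau e : R) (r : R * R * R) :
  admissible k tau e r -> admissible k tau e (exchange r).
Proof.
intro H; pose proof (phase1_exchange tau e r) as E1.
pose proof (phase2_exchange tau e r) as E2.
destruct r as [[al ph] xi]; destruct H as [? [? [? [D1 D2]]]].
unfold admissible, exchange in *; rewrite E1, E2.
refine (conj _ (conj _ (conj _ (conj D2 D1)))); lra.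
Qed.

Lemma admissible_Ds (tau e : R) (r : R * R * R) : admissible k tau e r ->
  Ds k (phase1 tau e r) /\ Ds k (phase2 tau e r).
Proof. destruct r as [[? ?] ?]; intros [_ [_ [_ HD]]]; exact HD. Qed.

Lemma phases_mixture (tau e : R) (r : R * R * R) : admissible k tau e r ->
  (tau, e)
  = segment_point (1 - snd (fst r)) (phase1 tau e r) (phase2 tau e r).
Proof.
destruct r as [[al ph] xi]; intros [? [? [? _]]].
unfold segment_point; simpl; f_equal; field; lra.
Qed.

(** The weight of (tau, e) between two phases of distinct volumes determines phi; volume and energy
    of phase 1 then give alpha and xi. *)
Lemma phase_fraction_unique (tau e : R) (r r' : R * R * R) :
  0 < tau -> 0 < e -> admissible k tau e r -> admissible k tau e r' ->
  fst (phase1 tau e r) <> fst (phase2 tau e r) ->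
  phase1 tau e r = phase1 tau e r' -> phase2 tau e r = phase2 tau e r' ->
  r = r'.
Proof.
intros Htau He Hr Hr' N E1 E2.
pose proof (phases_mixture tau e r Hr) as M.
pose proof (phases_mixture tau e r' Hr') as M'.
rewrite <- E1, <- E2, M in M'; apply (f_equal fst) in M'.
revert M' N E1; destruct r as [[al ph] xi], r' as [[al' ph'] xi'].
destruct Hr as [? [? [? _]]], Hr' as [? [? [? _]]].
intros M' N E1.
assert (ph = ph').
{ unfold segment_point in M'.
  set (v1 := fst (phase1 tau e (al, ph, xi))) in *.
  set (v2 := fst (phase2 tau e (al, ph, xi))) in *.
  simpl in M'. apply Rminus_diag_uniq, (Rmult_eq_reg_r (v1 - v2)); lra. }
subst ph'; simpl in E1; injection E1 as Ea Ex.
unfold Rdiv in *.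
apply Rmult_eq_reg_r in Ea; [| apply Rinv_neq_0_compat; lra].
apply Rmult_eq_reg_r in Ex; [| apply Rinv_neq_0_compat; lra].
apply Rmult_eq_reg_r in Ea; [| lra].
apply Rmult_eq_reg_r in Ex; [| lra].
congruence.
Qed.

Lemma phase1_bulk_diagonal (tau e : R) (r : R * R * R) :
  0 < tau -> 0 < e -> admissible k tau e r -> phase1 tau e r = (tau, e) ->
  exists beta : R, 0 < beta < 1 /\ r = (beta, beta, beta).
Proof.
destruct r as [[al ph] xi]; intros Htau He [? [? [? _]]] E.
simpl in E; injection E as Ea Ex; exists ph; split; [assumption |].
assert (al = ph).
{ apply (Rmult_eq_reg_r (tau / ph)).
  - transitivity (al * tau / ph); [field; lra | rewrite Ea; field; lra].
  - apply Rgt_not_eq, Rdiv_lt_0_compat; lra. }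
assert (xi = ph).
{ apply (Rmult_eq_reg_r (e / ph)).
  - transitivity (xi * e / ph); [field; lra | rewrite Ex; field; lra].
  - apply Rgt_not_eq, Rdiv_lt_0_compat; lra. }
congruence.
Qed.

(** * The two Lyapunov functions *)

Lemma lyapunov_saturation (conc : R * R -> R) (tau e : R) (q1 q2 : R * R)
    (rstar : R * R * R) :
  0 < tau -> 0 < e -> saturation_couple k conc q1 q2 ->
  admissible k tau e rstar ->
  phase1 tau e rstar = q1 -> phase2 tau e rstar = q2 ->
  is_lyapunov (admissible k tau e) (vector_field k tau e)
    (fun r => r = rstar \/ r = exchange rstar) (G_S k conc tau e).
Proof.
intros Htau He Hc Ha P1 P2.
pose proof (phases_mixture tau e rstar Ha) as M; rewrite P1, P2 in M.
assert (Hl : 0 < 1 - snd (fst rstar) < 1).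
{ destruct rstar as [[? ?] ?]; destruct Ha as [? [? _]]; simpl; lra. }
pose proof (couple_volume_neq conc q1 q2 Hc) as N.
pose proof (couple_hull_tangent_plane conc q1 q2 Hc (1 - snd (fst rstar)) (tau, e)
  ltac:(lra) M) as EL.
(* The weight lies strictly between 0 and 1 and the volumes differ, so (tau, e) is not an
   endpoint. *)
assert (Hxq : (tau, e) <> q1 /\ (tau, e) <> q2).
{ split; intro E; rewrite E in M; apply (f_equal fst) in M;
    unfold segment_point in M; simpl in M; apply N;
    [apply (Rmult_eq_reg_l (1 - snd (fst rstar)))
    | apply (Rmult_eq_reg_l (snd (fst rstar)))]; lra. }
apply is_lyapunov_minus_mixture_entropy; try assumption.
- assert (mixture_entropy k tau e rstar = conc (tau, e)).
  { rewrite EL, (tangent_plane_mixture q1 _ _ _ _ M).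
    rewrite tangent_plane_self,
      (couple_tangent_plane_right conc q1 q2 Hc), <- P1, <- P2.
    destruct rstar as [[? ?] ?]; unfold mixture_entropy, fst at 2, snd; simpl; ring. }
  intros r [-> | ->]; [| rewrite mixture_entropy_exchange]; assumption.
- intros r Hr HN.
  destruct (admissible_Ds tau e r Hr) as [D1 D2].
  destruct (mixture_le_tangent_plane tau e q1 r Hr
    (couple_tangent_plane_le conc q1 q2 Hc _ D1)
    (couple_tangent_plane_le conc q1 q2 Hc _ D2)) as [Hle Heq].
  rewrite EL; destruct Hle as [Hlt | E]; [exact Hlt | exfalso].
  destruct (Heq E) as [E1 E2].
  apply (couple_tangent_plane_eq conc q1 q2 Hc _ D1) in E1.
  apply (couple_tangent_plane_eq conc q1 q2 Hc _ D2) in E2.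
  pose proof (phases_mixture tau e r Hr) as Mr.
  assert (Hsame : phase1 tau e r = phase2 tau e r -> phase1 tau e r = (tau, e)).
  { intro Es; rewrite Mr, <- Es.
    unfold segment_point; destruct (phase1 tau e r); simpl; f_equal; ring. }
  (* Equal phases would make (tau, e) an endpoint; the two mixed cases are [rstar] and its
     exchange. *)
  destruct E1 as [E1 | E1], E2 as [E2 | E2].
  + apply (proj1 Hxq); rewrite <- E1; symmetry; apply Hsame; congruence.
  + apply HN; left; apply (phase_fraction_unique tau e); congruence.
  + apply HN; right; apply (phase_fraction_unique tau e); try assumption.
    * apply admissible_exchange, Ha.
    * rewrite E1, E2; auto.
    * rewrite phase1_exchange; congruence.
    * rewrite phase2_exchange; congruence.
  + apply (proj2 Hxq); rewrite <- E1; symmetry; apply Hsame; congruence.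
Qed.

(** Here [q1] is the dome state below (tau, e) at the same volume, hence colder. The tangent plane
    at (tau, e) then touches the entropy only there, so a maximal mixture has phase 1 equal to (tau,
    e). *)
Lemma lyapunov_identification (conc : R * R -> R) (tau e : R)
    (q1 q2 : R * R) :
  0 < tau -> 0 < e -> Ds k (tau, e) -> saturation_couple k conc q1 q2 ->
  fst q1 = tau -> snd q1 < e ->
  is_lyapunov (admissible k tau e) (vector_field k tau e)
    (fun r => exists beta : R, 0 < beta < 1 /\ r = (beta, beta, beta))
    (G_I k tau e).
Proof.
intros Htau He Hx Hc Ev Ee.
assert (HT : temperature k q1 < temperature k (tau, e)).
{ destruct q1 as [v w]; simpl in *; subst v.
  apply Rmult_lt_compat_l; [apply Rinv_0_lt_compat |]; lra. }
assert (Hst : forall y, Ds k y -> y <> (tau, e) ->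
  entropy k y < tangent_plane k (tau, e) y).
{ intros y Hy Ny; apply (stable_above_couple conc q1 q2); auto. }
assert (Hself : tangent_plane k (tau, e) (tau, e) = entropy k (tau, e)).
{ apply tangent_plane_self. }
assert (Hle : forall y, Ds k y -> entropy k y <= tangent_plane k (tau, e) y).
{ intros y Hy; destruct (classic (y = (tau, e))) as [-> | Ny];
    [rewrite Hself; apply Rle_refl | apply Rlt_le, Hst; assumption]. }
apply is_lyapunov_minus_mixture_entropy; try assumption.
- intros r [beta [Hb ->]]; unfold mixture_entropy, phase1, phase2.
  replace (beta * tau / beta) with tau by (field; lra).
  replace (beta * e / beta) with e by (field; lra).
  replace ((1 - beta) * tau / (1 - beta)) with tau by (field; lra).
  replace ((1 - beta) * e / (1 - beta)) with e by (field; lra).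
  ring.
- intros r Hr HN.
  destruct (admissible_Ds tau e r Hr) as [D1 D2].
  destruct (mixture_le_tangent_plane tau e (tau, e) r Hr (Hle _ D1) (Hle _ D2))
    as [Hm Heq].
  rewrite <- Hself; destruct Hm as [Hlt | E]; [exact Hlt | exfalso].
  apply HN, (phase1_bulk_diagonal tau e); try assumption.
  apply NNPP; intro Ny; apply (Hst _ D1) in Ny.
  destruct (Heq E) as [E1 _]; lra.
Qed.

End VanDerWaals.

Theorem proposition6 (k : vdw)
    (hR : 0 < vdw_R k) (hCv : 0 < vdw_Cv k)
    (ha : 0 <= vdw_a k) (hb : 0 <= vdw_b k)
    (conc : R * R -> R) (hconc : is_concave_hull (Ds k) (entropy k) conc)
    (tau e : R) (hD : Ds k (tau, e)) (htau : 0 < tau) (he : 0 < e) :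
  (Z_spinodal k (tau, e) ->
   forall (q1 q2 : R * R) (rstar : R * R * R),
     saturation_couple k conc q1 q2 ->
     (exists l : R, 0 <= l <= 1 /\ (tau, e) = segment_point l q1 q2) ->
     admissible k tau e rstar ->
     phase1 tau e rstar = q1 -> phase2 tau e rstar = q2 ->
     is_lyapunov (admissible k tau e) (vector_field k tau e)
       (fun r => r = rstar \/ r = exchange rstar)
       (G_S k conc tau e))
  /\
  (forall (dom : R -> Prop) (gs : R -> R) (Tc : R),
     dome_graph k conc dom gs ->
     is_critical_temperature k Tc ->
     Z_stable k dom gs Tc (tau, e) ->
     is_lyapunov (admissible k tau e) (vector_field k tau e)
       (fun r => exists beta : R, 0 < beta < 1 /\ r = (beta, beta, beta))
       (G_I k tau e)).
Proof.
split.
- intros _ q1 q2 rstar Hc _ Ha P1 P2.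
  apply lyapunov_saturation with q1 q2; assumption.
- intros dom gs Tc Hdome _ [_ [Hdom [Hgs _]]].
  (* The dome point at volume tau may be either state of its couple; symmetry lets it come first. *)
  destruct (proj2 (Hdome tau (gs tau)) (conj Hdom eq_refl))
    as [q1 [q2 [Hc [E | E]]]].
  + apply lyapunov_identification with conc q1 q2; subst q1; auto.
  + apply saturation_couple_sym in Hc.
    apply lyapunov_identification with conc q2 q1; subst q2; auto.
Qed.
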